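(* There is no $3$-uniform Šoltés' hypergraph of order $9$.
   Context: A hypergraph $H=(V,E)$ consists of a finite vertex set $V$ and a set $E$ of distinct subsets of $V$ (hyperedges). $H$ is $k$-uniform if every hyperedge has exactly $k$ elements. The order of $H$ is $|V|$. For $u,w\in V$, the distance $d_H(u,w)$ is the least $\ell\ge 0$ such that there are vertices $u=x_0,\dots,x_\ell=w$ with $x_{i-1},x_i$ contained in a common hyperedge for each $i$ ($\infty$ if none exists); $H$ is connected if all distances are finite. $W(H)=\sum_{\{u,w\}\subseteq V,\,u\ne w} d_H(u,w)$. For $v\in V$, $H\setminus v$ has vertex set $V\setminus\{v\}$ and hyperedge set $\{e\in E: v\notin e\}$. A Šoltés' hypergraph is a connected hypergraph $H$ with $W(H\setminus v)=W(H)$ for every $v\in V$. *)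

(* Defs.v *)
From HB Require Import structures.
From mathcomp Require Import all_boot.

Set Implicit Arguments.
Unset Strict Implicit.
Unset Printing Implicit Defensive.

(* The ambient finType T only hosts the vertices: the vertex set is an explicit
   subset of it, so that vertex deletion stays over the same type. *)
Record hypergraph (T : finType) := Hypergraph {
  vertices : {set T};
  hyperedges : {set {set T}};
  hyperedges_sub : hyperedges \subset powerset vertices
}.

Definition horder (T : finType) (H : hypergraph T) : nat := #|vertices H|.

Definition uniform (T : finType) (k : nat) (H : hypergraph T) : Prop :=
  forall e : {set T}, e \in hyperedges H -> #|e| = k.

(* Extended natural numbers, with None standing for infinity. *)
Definition enat := option nat.

Definition eadd (m n : enat) : enat :=
  if (m, n) is (Some a, Some b) then Some (a + b) else None.

Lemma eaddA : associative eadd.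
Proof. by move=> [a|] [b|] [c|] //; rewrite /eadd addnA. Qed.

Lemma eaddC : commutative eadd.
Proof. by move=> [a|] [b|] //; rewrite /eadd addnC. Qed.

Lemma add0e : left_id (Some 0) eadd.
Proof. by case. Qed.

HB.instance Definition _ :=
  Monoid.isComLaw.Build enat (Some 0) eadd eaddA eaddC add0e.

Section Distance.

Variables (T : finType) (H : hypergraph T).

Definition coedge : rel T :=
  fun x y => [exists e in hyperedges H, (x \in e) && (y \in e)].

(* With x_0 = u, the tuple p lists x_1, ..., x_l. *)
Definition has_walk (u w : T) (l : nat) : bool :=
  [exists p : l.-tuple T, path coedge u p && (last u p == w)].

Lemma has_walkP (u w : T) :
  reflect (exists l, has_walk u w l) (connect coedge u w).
Proof.
apply: (iffP connectP) => [[p pth ->]|[l /existsP[p /andP[pth /eqP <-]]]].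
  by exists (size p); apply/existsP; exists (in_tuple p); rewrite pth eqxx.
by exists p.
Qed.

Definition distance (u w : T) : enat :=
  match has_walkP u w with
  | ReflectT ex => Some (ex_minn ex)
  | ReflectF _ => None
  end.

Lemma coedgeC : symmetric coedge.
Proof. by move=> x y; apply: eq_existsb => e; rewrite [(y \in e) && _]andbC. Qed.

Lemma has_walkC (u w : T) (l : nat) : has_walk u w l = has_walk w u l.
Proof.
suff imp x y : has_walk x y l -> has_walk y x l by apply/idP/idP; apply: imp.
case/existsP=> p /andP[pth /eqP <-]; apply/existsP.
have sz : size (rev (belast x p)) == l by rewrite size_rev size_belast size_tuple.
exists (Tuple sz) => /=; rewrite rev_path.
rewrite (eq_path (e' := coedge)) => [|a b]; last by rewrite coedgeC.
rewrite pth /=; case: (tval p) => //= a s.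
by rewrite rev_cons last_rcons.
Qed.

Lemma distanceC (u w : T) : distance u w = distance w u.
Proof.
rewrite /distance; case: has_walkP => [ex1|n1]; case: has_walkP => [ex2|n2] //.
- by congr Some; apply: eq_ex_minn => l; apply: has_walkC.
- by case: n2; case: ex1 => l hl; exists l; rewrite has_walkC.
- by case: n1; case: ex2 => l hl; exists l; rewrite has_walkC.
Qed.

Definition connected : Prop :=
  forall u w : T, u \in vertices H -> w \in vertices H -> distance u w <> None.

(* Each unordered pair {u, w} is counted once, by listing first its element of
   smaller rank in the enumeration of T; by distanceC the order is immaterial. *)
Definition wiener : enat :=
  \big[eadd/Some 0]_(u in vertices H)
    \big[eadd/Some 0]_(w in vertices H | enum_rank u < enum_rank w)
      distance u w.

Lemma delete_vertex_sub (v : T) :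
  [set e in hyperedges H | v \notin e] \subset powerset (vertices H :\ v).
Proof.
apply/subsetP=> e; rewrite inE => /andP[eE ve].
by rewrite powersetE subsetD1 ve andbT -powersetE (subsetP (hyperedges_sub H)).
Qed.

Definition delete_vertex (v : T) : hypergraph T :=
  Hypergraph (delete_vertex_sub v).

End Distance.

Definition soltes (T : finType) (H : hypergraph T) : Prop :=
  connected H /\
  forall v : T, v \in vertices H -> wiener (delete_vertex H v) = wiener H.

(* Main.v *)
Require Import Defs.
From mathcomp Require Import all_boot.

Set Implicit Arguments.
Unset Strict Implicit.
Unset Printing Implicit Defensive.

(** Summing [W(H \ v) = W(H)] over the nine vertices and comparing pair by pair,
    [9 d(u,w)] equals on average the sum of [d_(H\v)(u,w)] over the seven [v]
    different from [u] and [w].  Only the vertices of an edge (two edges) joining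
    [u] to [w] can increase a distance 1 (2), so if every [H \ v] had diameter at
    most 3, all pairs would be adjacent and lie in exactly one edge, and then
    deleting [v] from an edge [{u,v,w}] leaves [u] and [w] at distance 2, which is
    too small.

    Hence some [H \ v] contains a geodesic [x0 x1 x2 x3 x4].  Its four edges use
    at most three further vertices, which leaves four configurations.  Each is
    refuted by deciding the remaining triples one after the other: if the edges
    include [A] and are included in [U], all ten Wiener indices equal a number that
    is at least [W(U \ x)] and at most [W(A \ x)] for every [x]. *)

(** * Distances and the Wiener index *)

Section Distances.

Variables (T : finType) (H : hypergraph T).
Implicit Types (u w x y : T) (e : {set T}).

(** An infinite distance is read as 0, so a bound on [dist] says nothing about finiteness. Passing
    from [dist] to a walk always goes through a proof that the distance is finite. *)
Definition dist u w : nat := odflt 0 (distance H u w).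

Lemma has_walkE u w l :
  has_walk H u w l <->
  exists p, [/\ size p = l, path (coedge H) u p & last u p = w].
Proof.
split=> [/existsP[p /andP[pth /eqP lst]]|[p [sz pth lst]]].
  by exists p; rewrite size_tuple.
move/eqP: sz => sz; apply/existsP; exists (Tuple sz).
by rewrite /= pth lst eqxx.
Qed.

Lemma has_walk0 u : has_walk H u u 0.
Proof. by apply/has_walkE; exists [::]. Qed.

Lemma has_walkS u w l :
  has_walk H u w l.+1 <-> exists2 y, has_walk H u y l & coedge H y w.
Proof.
split=> [/has_walkE[p]|[y /has_walkE[p [sz pth lst]] yw]].
  case/lastP: p => [[]//|p z]; rewrite size_rcons rcons_path last_rcons.
  case=> -[sz] /andP[pth lz] zw; subst z; exists (last u p) => //.
  by apply/has_walkE; exists p.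
apply/has_walkE; exists (rcons p w).
by rewrite size_rcons sz rcons_path pth lst yw last_rcons.
Qed.

Lemma has_walk1 u w : has_walk H u w 1 <-> coedge H u w.
Proof.
split=> [/has_walkS[y /has_walkE[[|? ?] [] //= _ _ <-]] //|uw].
by apply/has_walkS; exists u => //; apply: has_walk0.
Qed.

Lemma coedgeP u w :
  reflect (exists e, [/\ e \in hyperedges H, u \in e & w \in e]) (coedge H u w).
Proof.
apply: (iffP existsP) => [[e /and3P[eE ue we]]|[e [eE ue we]]]; exists e => //.
by rewrite eE ue.
Qed.

Lemma edge_vertex e u : e \in hyperedges H -> u \in e -> u \in vertices H.
Proof.
move=> eE; have := subsetP (hyperedges_sub H) _ eE.
by rewrite powersetE => /subsetP; apply.
Qed.

Lemma distance_le u w l :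
  has_walk H u w l -> exists2 d, distance H u w = Some d & d <= l.
Proof.
rewrite /distance => uwl; case: has_walkP => [ex|[]]; last by exists l.
by exists (ex_minn ex) => //; case: ex_minnP => m _; apply.
Qed.

Lemma dist_le u w l : has_walk H u w l -> dist u w <= l.
Proof. by rewrite /dist => /distance_le[d ->]. Qed.

Lemma dist_walk u w : distance H u w <> None -> has_walk H u w (dist u w).
Proof.
by rewrite /dist /distance; case: has_walkP => // ex _ /=; case: ex_minnP.
Qed.

Lemma dist_refl u : dist u u = 0.
Proof. by apply/eqP; rewrite -leqn0; apply: dist_le (has_walk0 u). Qed.

Lemma dist_eq0 u w : distance H u w <> None -> dist u w = 0 -> u = w.
Proof. by move=> /dist_walk + d0; rewrite d0 => /has_walkE[[|? ?] []]. Qed.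

Lemma distC u w : dist u w = dist w u.
Proof. by rewrite /dist distanceC. Qed.

Lemma has_walk_path u y p l : has_walk H u y l -> path (coedge H) y p ->
  has_walk H u (last y p) (l + size p).
Proof.
move=> /has_walkE[q [<- qth <-]] pth; apply/has_walkE; exists (q ++ p).
by rewrite size_cat cat_path qth last_cat.
Qed.

Lemma dist_coedge u y w :
  distance H u y <> None -> coedge H y w -> dist u w <= (dist u y).+1.
Proof.
by move=> /dist_walk uy yw; apply/dist_le/has_walkS; exists y.
Qed.

Lemma walk_vertices u p : path (coedge H) u p -> {subset p <= vertices H}.
Proof.
elim: p u => //= w p IHp u /andP[/coedgeP[e [eE _ we]] /IHp sub] x.
by rewrite inE => /predU1P[->|/sub//]; apply: edge_vertex we.
Qed.

(** A walk without repeated vertices visits at most all of the vertex set, and every walk shortens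
    to such a one. *)
Lemma dist_lt_card u w : u \in vertices H -> distance H u w <> None ->
  dist u w < #|vertices H|.
Proof.
move=> uV /dist_walk/has_walkE[p [_ pth]].
case/shortenP: pth => q qth uniq_q _ lst.
have: has_walk H u w (size q) by apply/has_walkE; exists q.
move/dist_le => le_q; apply: leq_ltn_trans le_q _.
rewrite -[(size q).+1]/(size (u :: q)) -(card_uniqP uniq_q) subset_leq_card //.
by apply/subsetP=> x; rewrite inE => /predU1P[->|/(walk_vertices qth)].
Qed.

(** [None] absorbs in [eadd], so a single infinite term makes the whole sum infinite. The induction
    runs over an arbitrary suffix of the index list. *)
Lemma big_eadd_Some (I : finType) (P : pred I) (F : I -> enat) n :
  \big[eadd/Some 0]_(i | P i) F i = Some n ->
  (forall i, P i -> F i <> None) /\ \sum_(i | P i) odflt 0 (F i) = n.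
Proof.
move=> sumF; suff [memF sumn] : (forall i, i \in index_enum I -> P i -> F i <> None)
    /\ \sum_(i | P i) odflt 0 (F i) = n.
  by split=> // i; apply: memF; rewrite mem_index_enum.
elim: (index_enum I) n sumF => [|i r IHr] n; first by rewrite !big_nil => -[].
rewrite !big_cons; case: ifPn => [Pi|nPi].
  case Fi: (F i) => [a|] //.
  case: (\big[eadd/_]_(j <- r | P j) F j) IHr => //= b IHr [<-].
  have [memF ->] := IHr _ erefl; split=> // j; rewrite inE => /predU1P[->|/memF//].
  by rewrite Fi.
move/IHr=> [memF ->]; split=> // j; rewrite inE => /predU1P[->|/memF//].
by rewrite (negPf nPi).
Qed.

Lemma connected_wiener : connected H -> wiener H <> None.
Proof.
have add_fin (a b : enat) : a <> None -> b <> None -> eadd a b <> None.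
  by case: a b => [a|] [b|].
move=> connH; apply: (big_ind (fun a => a <> None)) => // u uV.
apply: (big_ind (fun a => a <> None)) => // w /andP[wV _].
exact: connH.
Qed.

(** Ordered pairs count each unordered pair twice, which removes the rank condition. Connectedness
    of every [H \ v] is obtained here, from the finiteness of its Wiener index. *)
Lemma wiener_dist n : wiener H = Some n -> connected H /\
  \sum_(u in vertices H) \sum_(w in vertices H) dist u w = n.*2.
Proof.
rewrite /wiener => /big_eadd_Some[finH sumH].
pose lt u w := enum_rank u < enum_rank w.
have conn u w : u \in vertices H -> w \in vertices H -> lt u w ->
    distance H u w <> None.
  move=> uV wV uw; case E: (\big[_/_]_(w in _ | _) _) (finH _ uV) => [m|] // _.
  by have [+ _] := big_eadd_Some E; apply; rewrite wV.
split.
  move=> u w uV wV; case: (ltngtP (enum_rank u) (enum_rank w)) => [|wu|/val_inj].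
  - exact: conn.
  - by rewrite distanceC; apply: conn.
  - by move/enum_rank_inj => ->; have [d ->] := distance_le (has_walk0 w).
have half : \sum_(u in vertices H) \sum_(w in vertices H | lt u w) dist u w = n.
  rewrite -[RHS]sumH; apply: eq_bigr => u uV.
  case E: (\big[eadd/_]_(w in _ | _) _) (finH _ uV) => [m|] // _.
  by have [_ ->] := big_eadd_Some E.
rewrite -addnn -{1}half -[in RHS]half.
(* The second copy of the half sum is transposed, so that in each row it supplies the [w] of smaller
   rank; the diagonal term is 0. *)
rewrite [X in _ + X](exchange_big_dep (mem (vertices H))) /=; last first.
  by move=> ? ? _ /andP[].
rewrite -big_split; apply: eq_bigr => u uV; rewrite (bigID (lt u)) /=.
congr (_ + _); rewrite (bigD1 u) /= ?uV /lt ?ltnn // dist_refl add0n.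
apply: eq_big => [w|w _]; last exact: distC.
rewrite -leqNgt [in RHS]ltn_neqAle.
rewrite [_ == _ :> nat](inj_eq (inj_comp val_inj enum_rank_inj)).
by rewrite -andbA [(_ <= _) && _]andbC.
Qed.

End Distances.

(** * Averaging over the deleted vertex *)

Lemma coedge_delete (T : finType) (H : hypergraph T) (e : {set T}) (v x y : T) :
  e \in hyperedges H -> v \notin e -> x \in e -> y \in e ->
  coedge (delete_vertex H v) x y.
Proof. by move=> eE ve xe ye; apply/coedgeP; exists e; rewrite inE eE. Qed.

Lemma eq_sum_leq (I : finType) (P : pred I) (E1 E2 : I -> nat) :
  (forall i, P i -> E1 i <= E2 i) ->
  \sum_(i | P i) E1 i = \sum_(i | P i) E2 i -> forall i, P i -> E1 i = E2 i.
Proof.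
move=> leE eqE i Pi; apply/eqP.
have /leqif_sum[_] : forall j, P j -> E1 j <= E2 j ?= iff (E1 j == E2 j).
  by move=> j /leE.
by rewrite eqE eqxx => /esym/forall_inP; apply.
Qed.

Section Counting.

Variables (T : finType) (H : hypergraph T).
Implicit Types (u w v x y : T) (e X : {set T}).

Hypotheses (H3 : uniform 3 H) (H9 : horder H = 9).
Let V := vertices H.

(** The value 0 when [v] is [u] or [w] lets all three indices range over [V], so that the sums can
    be exchanged. *)
Let dist_del v u w :=
  if (u != v) && (w != v) then dist (delete_vertex H v) u w else 0.
Let sum_del u w := \sum_(v in V) dist_del v u w.

(** There are seven choices of [v] besides [u] and [w]. [X] collects those whose deletion may raise
    the distance from [a] to [a + b]. *)
Lemma sum_del_le u w (a b : nat) X : u != w -> u \in V -> w \in V ->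
  (forall v, v \in V -> v != u -> v != w ->
     dist (delete_vertex H v) u w <= a + b * (v \in X)) ->
  sum_del u w <= 7 * a + b * #|X :\: [set u; w]|.
Proof.
move=> uw uV wV le_ab.
have card7 : #|V :\: [set u; w]| = 7.
  have sub : [set u; w] \subset V by apply/subsetP=> x; rewrite !inE => /orP[]/eqP->.
  by rewrite cardsD (setIidPr sub) cards2 uw -/(horder H) H9.
apply: (@leq_trans (\sum_(v in V :\: [set u; w]) (a + b * (v \in X)))).
  rewrite /sum_del [X in _ <= X]big_mkcond [X in X <= _]big_mkcond /=.
  apply: leq_sum => v _; rewrite !inE /dist_del -negb_or eq_sym [w == v]eq_sym.
  case: ifP => vV; last by rewrite andbF.
  case: ifP => //; rewrite negb_or andbT => /andP[vu vw].
  exact: le_ab.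
rewrite big_split /= sum_nat_const card7 leq_add2l -big_distrr /= leq_mul2l.
apply/orP; right; rewrite -big_mkcondr /= sum1_card subset_leq_card //.
by apply/subsetP=> v; rewrite unfold_in !inE => /andP[/andP[-> _] ->].
Qed.

Hypothesis diam_del : forall v u w, v \in V -> u \in V :\ v -> w \in V :\ v ->
  dist (delete_vertex H v) u w <= 3.
Hypothesis connH : connected H.

Lemma sum_del_le_diam u w : u != w -> u \in V -> w \in V -> sum_del u w <= 21.
Proof.
move=> uw uV wV; have := @sum_del_le u w 3 0 set0 uw uV wV; apply.
move=> v vV vu vw; rewrite addn0; apply: diam_del => //.
  by rewrite !inE eq_sym vu.
by rewrite !inE eq_sym vw.
Qed.

Lemma coedge_of_dist1 u w : u \in V -> w \in V -> dist H u w = 1 ->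
  coedge H u w.
Proof.
move=> uV wV d1; apply/has_walk1; rewrite -d1; apply: dist_walk.
exact: connH.
Qed.

Lemma card_edge_minus2 e u w : e \in hyperedges H -> u != w ->
  u \in e -> w \in e -> #|e :\: [set u; w]| = 1.
Proof.
move=> eE uw ue we; have sub : [set u; w] \subset e.
  by apply/subsetP=> x; rewrite !inE => /orP[]/eqP->.
by rewrite cardsD (setIidPr sub) cards2 uw (H3 eE).
Qed.

Lemma dist_del_edge e v u w :
  e \in hyperedges H -> u \in e -> w \in e -> v \notin e ->
  dist (delete_vertex H v) u w <= 1.
Proof.
move=> eE ue we ve.
by apply: dist_le; apply/has_walk1; apply: coedge_delete ve ue we.
Qed.

Lemma dist_del_le3 v u w : v \in V -> u \in V -> w \in V -> v != u -> v != w ->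
  dist (delete_vertex H v) u w <= 3.
Proof.
move=> vV uV wV vu vw.
by apply: diam_del; rewrite // !inE eq_sym ?vu ?vw.
Qed.

(** At distance 1, only the third vertex of a joining edge can raise the distance, to at most 3: 7 +
    2 = 9. At distance 2, two edges sharing a vertex contain at most three vertices besides [u] and
    [w]: 14 + 3 < 18. At distance 3 or more, the diameter bound gives 21 < 27. *)
Lemma sum_del_dist u w : u != w -> u \in V -> w \in V ->
  sum_del u w <= 9 * dist H u w /\ (sum_del u w = 9 * dist H u w -> dist H u w = 1).
Proof.
move=> uw uV wV.
have fin : distance H u w <> None by apply: connH.
have walk := dist_walk fin.
have d0 : dist H u w <> 0 by move/(dist_eq0 fin)/eqP; rewrite (negPf uw).
case: (dist H u w) walk d0 => [//|[|[|d]]] walk _.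
- split=> //; case/has_walk1/coedgeP: walk => e [eE ue we].
  rewrite muln1.
  apply: leq_trans (sum_del_le (a := 1) (b := 2) (X := e) uw uV wV _) _.
    move=> v vV vu vw; case: (boolP (v \in e)) => ve; first exact: dist_del_le3.
    exact: dist_del_edge ve.
  by rewrite (card_edge_minus2 eE).
- suff lt18 : sum_del u w <= 17.
    by split=> [|eq18]; [exact: leqW|rewrite eq18 in lt18].
  case/has_walkS: walk => y /has_walk1/coedgeP[e1 [e1E ue1 ye1]].
  case/coedgeP=> e2 [e2E ye2 we2].
  apply: leq_trans (sum_del_le (a := 2) (b := 1) (X := e1 :|: e2) uw uV wV _) _.
    move=> v vV vu vw; case: (boolP (v \in _)) => [_|].
      exact: dist_del_le3.
    rewrite inE negb_or => /andP[ve1 ve2]; apply: dist_le; apply/has_walkS; exists y.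
      by apply/has_walk1; apply: coedge_delete ve1 ue1 ye1.
    exact: coedge_delete ve2 ye2 we2.
  have sub : [set u; w] \subset e1 :|: e2.
    by apply/subsetP=> x; rewrite !inE => /orP[]/eqP->; rewrite ?ue1 ?we2 ?orbT.
  have : 0 < #|e1 :&: e2| by apply/card_gt0P; exists y; rewrite inE ye1.
  rewrite cardsD (setIidPr sub) cards2 uw cardsU (H3 e1E) (H3 e2E).
  case: #|e1 :&: e2| => // n _; rewrite mul1n (leq_add2l 14 _ 3).
  by rewrite subSS -subnDA addnC subnDA leq_subr.
- have lt21 := sum_del_le_diam uw uV wV.
  suff lt27 : sum_del u w < 9 * d.+3.
    by split=> [|eq27]; [exact: ltnW|rewrite eq27 ltnn in lt27].
  by apply: leq_ltn_trans lt21 _; rewrite !mulnS.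
Qed.

(** Take an edge [e] = {[u], [w], [z]} and [y] outside it. Edges [f] through [u], [y] and [g]
    through [w], [y] avoid [z], so after deleting [z] the walk [u], [y], [w] has length 2. Then
    [sum_del u w] is at most 7 + 1, not 9. *)
Lemma not_all_tight :
  ~ (forall u w, u != w -> u \in V -> w \in V -> sum_del u w = 9 /\ coedge H u w).
Proof.
move=> tight.
have [u uV] : exists u, u \in V by apply/card_gt0P; rewrite -/(horder H) H9.
have outside (X : {set T}) : #|X| < 9 -> exists2 y, y \in V & y \notin X.
  move=> X9; apply/subsetPn; apply: contraTN X9 => /subset_leq_card.
  by rewrite -/(horder H) H9 -leqNgt.
have [|w wV] := outside [set u]; first by rewrite cards1.
rewrite inE eq_sym => uw.
have [_ /coedgeP[e [eE ue we]]] := tight _ _ uw uV wV.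
have /eqP/cards1P[z ez] := card_edge_minus2 eE uw ue we.
have /setDP[ze zuw] : z \in e :\: [set u; w] by rewrite ez set11.
have {zuw}[zu zw] : z != u /\ z != w by move: zuw; rewrite !inE negb_or => /andP.
have zV := edge_vertex eE ze.
have [|y yV ye] := outside e; first by rewrite H3.
have eP x : x \in e -> y != x by apply: contraTneq => <-.
(* Otherwise {x, z} lies in the two edges e and f. *)
have missz x f : x \in e -> x != z -> f \in hyperedges H -> x \in f -> y \in f ->
    z \notin f.
  move=> xe xz fE xf yf; apply/negP=> zf.
  have xV := edge_vertex eE xe.
  have [sum9 _] := tight _ _ xz xV zV.
  (* No deletion separates [x] from [z]: their only common neighbour in [f] is [y], which is outside
     [e], so every [v] misses [e] or [f]. *)
  suff : sum_del x z <= 7 * 1 + 0 * #|set0 :\: [set x; z]| by rewrite sum9.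
  apply: sum_del_le => // v vV vx vz.
  case: (boolP (v \in e)) => ve; last exact: dist_del_edge ve.
  have /eqP/cards1P[t ft] := card_edge_minus2 fE xz xf zf.
  have : v \notin f; last by move=> vf; apply: dist_del_edge vf.
  apply: contraNN (eP _ ve) => vf.
  have : v \in f :\: [set x; z] by rewrite !inE negb_or vx vz.
  have : y \in f :\: [set x; z] by rewrite !inE negb_or !eP.
  by rewrite ft !inE => /eqP-> /eqP->.
have [_ /coedgeP[f [fE uf yf]]] : sum_del u y = 9 /\ coedge H u y.
  by apply: tight; rewrite // eq_sym eP.
have [_ /coedgeP[g [gE wg yg]]] : sum_del w y = 9 /\ coedge H w y.
  by apply: tight; rewrite // eq_sym eP.
have [sum9 _] := tight _ _ uw uV wV.
suff : sum_del u w <= 7 * 1 + 1 * #|e :\: [set u; w]| by rewrite sum9 ez cards1.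
apply: sum_del_le => // v vV vu vw.
case: (boolP (v \in e)) => ve; last exact: dist_del_edge ve.
have : v \in e :\: [set u; w] by rewrite !inE negb_or vu vw.
rewrite ez inE => /eqP->; apply: dist_le; apply/has_walkS; exists y.
  have zf : z \notin f by apply: missz fE uf yf; rewrite // eq_sym.
  by apply/has_walk1; apply: coedge_delete zf uf yf.
have zg : z \notin g by apply: missz gE wg yg; rewrite // eq_sym.
exact: coedge_delete zg yg wg.
Qed.

(** Double counting: with [v] outermost, the nine deletions contribute [S] each, so the sums of
    [sum_del] and of nine times the distance agree. The termwise inequality is then an equality in
    every row, hence for every pair. *)
Lemma diam_del_contra S :
  \sum_(u in V) \sum_(w in V) dist H u w = S ->
  (forall v, v \in V ->
    \sum_(u in V :\ v) \sum_(w in V :\ v) dist (delete_vertex H v) u w = S) ->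
  False.
Proof.
move=> sumS sumvS.
have sum_mul : \sum_(u in V) \sum_(w in V) sum_del u w =
    \sum_(u in V) \sum_(w in V) 9 * dist H u w.
  under [RHS]eq_bigr => u _ do rewrite -big_distrr.
  rewrite -big_distrr /= sumS.
  under eq_bigr => u _ do rewrite exchange_big.
  rewrite exchange_big /= -H9 /horder -sum_nat_const.
  apply: eq_bigr => v vV; rewrite -(sumvS v vV).
  have inD u : (u \in V :\ v) = (u \in V) && (u != v) by rewrite !inE andbC.
  rewrite [RHS](eq_bigl _ _ inD).
  rewrite big_mkcondr; apply: eq_bigr => u uV.
  rewrite [X in if _ then X else _](eq_bigl _ _ inD).
  rewrite big_mkcondr /dist_del; case: (u != v) => //=.
  by rewrite big1.
have le_dist u w : u \in V -> w \in V -> sum_del u w <= 9 * dist H u w.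
  move=> uV wV; have [<-|uw] := eqVneq u w; last by have [] := sum_del_dist uw uV wV.
  rewrite dist_refl muln0 leqn0 /sum_del big1 // => v _.
  by rewrite /dist_del dist_refl; case: ifP.
apply: not_all_tight => u w uw uV wV.
have eqrow : \sum_(w in V) sum_del u w = \sum_(w in V) 9 * dist H u w.
  apply: (eq_sum_leq _ sum_mul uV) => u' u'V.
  by apply: leq_sum => w' w'V; apply: le_dist.
have eqs : sum_del u w = 9 * dist H u w.
  by apply: (eq_sum_leq _ eqrow wV) => w' w'V; apply: le_dist.
have [_ /(_ eqs) d1] := sum_del_dist uw uV wV.
by split; [rewrite eqs d1|apply: coedge_of_dist1].
Qed.

End Counting.

(** * Wiener indices of coded hypergraphs *)

Fixpoint bor (a b : bitseq) : bitseq :=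
  match a, b with
  | x :: a', y :: b' => (if x then true else y) :: bor a' b'
  | _, _ => b
  end.

Fixpoint meets (a b : bitseq) : bool :=
  match a, b with
  | x :: a', y :: b' =>
    if x then (if y then true else meets a' b') else meets a' b'
  | _, _ => false
  end.

(** Each edge is tested against [b] itself, not against the union built so far, so one call
    increases the radius by exactly one. *)
Fixpoint step (s : seq bitseq) (b : bitseq) : bitseq :=
  if s is m :: s' then
    if meets m b then bor m (step s' b) else step s' b
  else b.

(* If b codes a ball of radius r around u, then c vertices are at distance
   greater than r from u; summing c over all radii sums the distances. *)
Fixpoint radial_sum (n : nat) (s : seq bitseq) (k : nat) (b : bitseq) : nat :=
  let c := n - count id b in
  if c is 0 then 0 else
  if k is k'.+1 then c + radial_sum n s k' (step s b) else 0.

Definition point (n i : nat) : bitseq := [seq j == i | j <- iota 0 n].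

(* x = n stands for no deletion. *)
Definition coded_wiener (n : nat) (s : seq bitseq) (x : nat) : nat :=
  let s' := [seq m <- s | ~~ nth false m x] in
  sumn [seq radial_sum (n - (x < n)) s' n (point n i) | i <- iota 0 n & i != x].

Definition within (n : nat) (s : seq bitseq) (x i j r : nat) : bool :=
  nth false (iter r (step [seq m <- s | ~~ nth false m x]) (point n i)) j.

Lemma size_bor a b : size a = size b -> size (bor a b) = size b.
Proof. by elim: a b => [|x a IHa] [|y b] //= [/IHa->]. Qed.

Lemma nth_bor a b i : size a = size b ->
  nth false (bor a b) i = nth false a i || nth false b i.
Proof.
by elim: a b i => [|x a IHa] [|y b] [|i] //= [/IHa->].
Qed.

Lemma meetsP a b :
  reflect (exists i, nth false a i && nth false b i) (meets a b).
Proof.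
apply: (iffP idP) => [|[i]].
  elim: a b => [|[] a IHa] [|[] b] //= => [|/IHa[i ?]|/IHa[i ?]|/IHa[i ?]];
    by [exists 0|exists i.+1].
elim: a b i => [|x a IHa] [|y b] [|i] //=; rewrite ?andbF //.
- by case: x y => [] [].
- by move/IHa->; case: x y => [] [].
Qed.

Definition sized (n : nat) : pred (seq bitseq) := all (fun m => size m == n).

Lemma size_step n s b : sized n s -> size b = n -> size (step s b) = n.
Proof.
move=> + sb; elim: s => //= m s IHs /andP[/eqP sm /IHs szs].
by case: ifP => // _; rewrite size_bor ?sm.
Qed.

Lemma nth_step n s b i : sized n s -> size b = n ->
  nth false (step s b) i =
  nth false b i || has (fun m => meets m b && nth false m i) s.
Proof.
move=> + sb; elim: s => [|m s IHs] /=; first by rewrite orbF.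
case/andP=> /eqP sm szs; case: ifP => _ /=; last exact: IHs.
by rewrite nth_bor ?IHs ?(size_step szs sb) // orbCA.
Qed.

(** * Coded balls compared with true balls *)

Section Coding.

Variables (T : finType) (vs : seq T) (x0 : T).
Hypothesis uniq_vs : uniq vs.
Let n := size vs.

Implicit Types (y u w : T) (e : {set T}) (b m : bitseq).

Definition code e : bitseq := [seq y \in e | y <- vs].
Definition bit b y : bool := nth false b (index y vs).

Lemma size_code e : size (code e) = n. Proof. exact: size_map. Qed.

Lemma bit_code e y : y \in vs -> bit (code e) y = (y \in e).
Proof. by move=> yvs; rewrite /bit (nth_map y) ?index_mem // nth_index. Qed.

Lemma bit_point y u : y \in vs -> u \in vs ->
  bit (point n (index u vs)) y = (y == u).
Proof.
move=> yvs uvs; rewrite /bit (nth_map 0) ?size_iota ?index_mem //.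
rewrite nth_iota ?index_mem //.
by rewrite add0n (inj_in_eq (@index_inj _ y vs)) //; apply/idP.
Qed.

Lemma count_bit b : size b = n -> count id b = #|[set y in vs | bit b y]|.
Proof.
move=> sb; have {1}-> : b = [seq bit b y | y <- vs].
  apply: (@eq_from_nth _ false); rewrite ?size_map // => i ib.
  rewrite sb in ib; by rewrite (nth_map x0) // /bit index_uniq.
rewrite count_map -size_filter -(card_uniqP (filter_uniq _ uniq_vs)).
by apply: eq_card => y; rewrite !inE mem_filter andbC.
Qed.

Section Bounds.

Variables (G : hypergraph T) (s : seq bitseq).
Let V := vertices G.
Hypothesis V_vs : {subset V <= vs}.
Hypothesis connG : connected G.
Hypothesis sized_s : sized n s.

(** One unit is peeled off every distance exceeding [k]; iterating this gives the layer count
    computed by [radial_sum]. *)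
Lemma sum_subn_dist u k : \sum_(w in V) (dist G u w - k) =
  (#|V| - #|[set w in V | dist G u w <= k]|) + \sum_(w in V) (dist G u w - k.+1).
Proof.
have -> : #|V| - #|[set w in V | dist G u w <= k]| = \sum_(w in V) (k < dist G u w).
  rewrite -big_mkcondr sum1_card -(cardsID [set w | dist G u w <= k] V).
  rewrite [X in X + _ - _](_ : _ = #|[set w in V | dist G u w <= k]|) ?addKn.
    by apply: eq_card => w; rewrite !inE -ltnNge andbC.
  by apply: eq_card => w; rewrite !inE.
rewrite -big_split; apply: eq_bigr => w _ /=.
case: ltnP => [kd|dk]; first by rewrite add1n subnSK.
by move: (dk) (leqW dk); rewrite -!subn_eq0 => /eqP-> /eqP->.
Qed.

(** When [s] contains all edges, the coded ball contains the true one, so too few vertices count as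
    far. Stopping early only drops terms. *)
Lemma radial_sum_le u k r b : u \in V ->
  (forall e, e \in hyperedges G -> code e \in s) -> size b = n ->
  (forall w, w \in V -> dist G u w <= r -> bit b w) ->
  radial_sum #|V| s k b <= \sum_(w in V) (dist G u w - r).
Proof.
move=> uV cover; elim: k r b => [|k IHk] r b sb bP /=;
  case cE: (#|V| - count id b) => [//|c] //.
rewrite sum_subn_dist leq_add //; last first.
  apply: IHk => [|w wV dw]; first exact: size_step.
  rewrite /bit (nth_step _ sized_s sb); move: dw.
  rewrite leq_eqVlt => /predU1P[dw|dw]; last first.
    by rewrite [nth _ b _](bP _ wV dw).
  have := dist_walk (connG uV wV); rewrite dw.
  move=> /has_walkS[y uy /coedgeP[e [eE ye we]]].
  have yV := edge_vertex eE ye.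
  apply/orP; right; apply/hasP; exists (code e); first exact: cover.
  apply/andP; split; last by rewrite [nth _ _ _]bit_code ?V_vs.
  apply/meetsP; exists (index y vs); rewrite [nth _ _ _]bit_code ?V_vs // ye.
  by apply: bP => //; apply: dist_le.
rewrite -cE leq_sub2l // count_bit //; apply: subset_leq_card; apply/subsetP=> w.
by rewrite !inE => /andP[wV dw]; rewrite V_vs // bP.
Qed.

Lemma bit_step u r b : u \in V ->
  (forall m, m \in s -> exists2 e, e \in hyperedges G & m = code e) -> size b = n ->
  (forall w, w \in vs -> bit b w -> w \in V /\ dist G u w <= r) ->
  forall w, w \in vs -> bit (step s b) w -> w \in V /\ dist G u w <= r.+1.
Proof.
move=> uV real sb bP w wvs; rewrite /bit (nth_step _ sized_s sb).
case/orP=> [/(bP _ wvs)[-> dw]|]; first by split=> //; apply: leqW.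
case/hasP=> m /real[e eE ->] /andP[/meetsP[i /andP[ei bi]] we].
(* The default bit is [false], so a true bit lies within the list and belongs to some vertex of
   [vs]. *)
have ivs : i < n.
  by rewrite ltnNge; apply: contraTN ei => ?; rewrite nth_default ?size_code.
have ie : index (nth x0 vs i) vs = i by rewrite index_uniq.
have ivs' : nth x0 vs i \in vs by rewrite mem_nth.
move: we ei bi; rewrite -[nth _ _ _]/(bit _ _) bit_code // -ie.
rewrite -[nth _ _ _]/(bit _ _) bit_code // -[nth false b _]/(bit _ _).
move=> we ye /(bP _ ivs')[yV dy]; split; first exact: edge_vertex we.
apply: leq_trans (_ : (dist G u (nth x0 vs i)).+1 <= _) => //.
apply: dist_coedge; first exact: connG.
by apply/coedgeP; exists e.
Qed.

(** When [s] consists of true edges, the coded ball lies inside the true one, so too many vertices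
    count as far. A zero count means that the true ball already fills [V], and [r + k] bounds all
    distances, so neither way of stopping loses a term. *)
Lemma radial_sum_ge u k r b : u \in V ->
  (forall m, m \in s -> exists2 e, e \in hyperedges G & m = code e) -> size b = n ->
  (forall w, w \in V -> dist G u w <= r + k) ->
  (forall w, w \in vs -> bit b w -> w \in V /\ dist G u w <= r) ->
  \sum_(w in V) (dist G u w - r) <= radial_sum #|V| s k b.
Proof.
move=> uV real; elim: k r b => [|k IHk] r b sb dle bP /=.
  rewrite big1 // => w wV; apply/eqP; rewrite subn_eq0 -[r]addn0; exact: dle.
have le_c : #|V| - #|[set w in V | dist G u w <= r]| <= #|V| - count id b.
  rewrite leq_sub2l // count_bit //; apply: subset_leq_card; apply/subsetP=> w.
  by rewrite !inE => /andP[wvs /(bP _ wvs)[-> ->]].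
have step_bP := bit_step uV real sb bP.
case: (#|V| - count id b) le_c => [|c] le_c.
  rewrite big1 // => w wV; apply/eqP; rewrite subn_eq0.
  move: le_c; rewrite leqn0 subn_eq0 => le_c.
  have /eqP/setP/(_ w) : [set w in V | dist G u w <= r] == V.
    by rewrite eqEcard le_c andbT; apply/subsetP=> ?; rewrite inE => /andP[].
  by rewrite inE wV.
rewrite sum_subn_dist leq_add //; apply: IHk => //; first exact: size_step.
by move=> w wV; rewrite addSnnS; apply: dle.
Qed.

End Bounds.

(** * Coded Wiener indices of a hypergraph and of its vertex deletions *)

Section CodedWiener.

Variables (G : hypergraph T) (x : nat).
Hypothesis VG : vertices G = [set y in vs | index y vs != x].
Hypothesis connG : connected G.

Lemma sum_vertices (F : T -> nat) : \sum_(u in vertices G) F u =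
  \sum_(i <- iota 0 n | i != x) F (nth x0 vs i).
Proof.
rewrite VG (eq_bigl (fun y => (y \in vs) && (index y vs != x))); last first.
  by move=> y; rewrite inE.
rewrite big_mkcondr -big_uniq // -big_mkcond (big_nth x0) /index_iota subn0.
rewrite big_seq_cond [RHS]big_seq_cond; apply: eq_bigl => i.
by rewrite mem_iota add0n; case: ltnP => // ivs; rewrite index_uniq.
Qed.

Lemma card_vertices : #|vertices G| = n - (x < n).
Proof.
rewrite -sum1_card sum_vertices sum1_count.
have := count_predC (pred1 x) (iota 0 n).
rewrite size_iota count_uniq_mem ?iota_uniq // mem_iota add0n => sum_n.
by rewrite -[X in X - _]sum_n addKn.
Qed.

Lemma vertices_vs : {subset vertices G <= vs}.
Proof. by move=> y; rewrite VG inE => /andP[]. Qed.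

Lemma nth_code_del e : e \in hyperedges G -> nth false (code e) x = false.
Proof.
move=> eE; case: (ltnP x n) => [xn|nx]; last by rewrite nth_default ?size_code.
rewrite (nth_map x0) //; apply/negbTE/negP=> /(edge_vertex eE).
by rewrite VG inE index_uniq // eqxx andbF.
Qed.

Lemma coded_wiener_le s : sized n s ->
  (forall e, e \in hyperedges G -> code e \in s) ->
  coded_wiener n s x <= \sum_(u in vertices G) \sum_(w in vertices G) dist G u w.
Proof.
move=> sz cover; rewrite sum_vertices /coded_wiener sumnE big_map big_filter.
rewrite big_seq_cond [leqRHS]big_seq_cond; apply: leq_sum => i.
rewrite mem_iota add0n => /andP[ivs ix]; rewrite -card_vertices.
under [leqRHS]eq_bigr => w _ do rewrite -[dist _ _ _]subn0.
have iV : nth x0 vs i \in vertices G by rewrite VG inE mem_nth // index_uniq.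
apply: radial_sum_le => //.
- exact: vertices_vs.
- by apply/allP=> m; rewrite mem_filter => /andP[_ /(allP sz)].
- by move=> e eE; rewrite mem_filter nth_code_del //= cover.
- by rewrite size_map size_iota.
- move=> w wV; rewrite leqn0 => /eqP/dist_eq0 <-; last exact: connG.
  by rewrite -{1}(index_uniq x0 ivs uniq_vs) bit_point // mem_nth.
Qed.

Lemma coded_wiener_ge s : sized n s ->
  (forall m, m \in s -> ~~ nth false m x ->
     exists2 e, e \in hyperedges G & m = code e) ->
  \sum_(u in vertices G) \sum_(w in vertices G) dist G u w <= coded_wiener n s x.
Proof.
move=> sz real; rewrite sum_vertices /coded_wiener sumnE big_map big_filter.
rewrite big_seq_cond [leqRHS]big_seq_cond; apply: leq_sum => i.
rewrite mem_iota add0n => /andP[ivs ix]; rewrite -card_vertices.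
under eq_bigr => w _ do rewrite -[dist _ _ _]subn0.
have iV : nth x0 vs i \in vertices G by rewrite VG inE mem_nth // index_uniq.
apply: radial_sum_ge => //.
- by apply/allP=> m; rewrite mem_filter => /andP[_ /(allP sz)].
- by move=> m; rewrite mem_filter => /andP[mx ms]; apply: real.
- by rewrite size_map size_iota.
(* The [n] rounds suffice because distances are smaller than the number of vertices. *)
- move=> w wV; apply: ltnW; apply: leq_trans (dist_lt_card iV (connG iV wV)) _.
  by rewrite card_vertices leq_subr.
- move=> w wvs; rewrite -{1}(index_uniq x0 ivs uniq_vs) bit_point ?mem_nth //.
  by move/eqP->; rewrite dist_refl.
Qed.

Lemma within_dist s i j r : sized n s ->
  (forall m, m \in s -> ~~ nth false m x ->
     exists2 e, e \in hyperedges G & m = code e) ->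
  i < n -> i != x -> j < n -> within n s x i j r ->
  dist G (nth x0 vs i) (nth x0 vs j) <= r.
Proof.
move=> sz real ivs ix jvs; rewrite /within.
set s' := filter _ s; rewrite -{1}(index_uniq x0 jvs uniq_vs) -[nth _ _ _]/(bit _ _).
have iV : nth x0 vs i \in vertices G by rewrite VG inE mem_nth // index_uniq.
have sz' : sized n s' by apply/allP=> m; rewrite mem_filter => /andP[_ /(allP sz)].
have real' m : m \in s' -> exists2 e, e \in hyperedges G & m = code e.
  by rewrite mem_filter => /andP[mx ms]; apply: real.
suff ball w : w \in vs -> bit (iter r (step s') (point n i)) w ->
    w \in vertices G /\ dist G (nth x0 vs i) w <= r.
  by case/ball=> //; rewrite mem_nth.
have sp k : size (iter k (step s') (point n i)) = n.
  by elim: k => [|k IHk]; [rewrite size_map size_iota|apply: size_step].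
elim: r w => [|r IHr] w wvs.
  rewrite -{1}(index_uniq x0 ivs uniq_vs) bit_point ?mem_nth //.
  by move/eqP->; rewrite dist_refl.
exact: (bit_step connG sz' iV real' (sp r) IHr).
Qed.

End CodedWiener.

End Coding.

(** * The search *)

(** The range includes [x = n], the undeleted hypergraph, and the seed [h] retains the best bound
    found so far. *)
Definition upper (n : nat) (s : seq bitseq) (h : nat) : nat :=
  foldr minn h [seq coded_wiener n s x | x <- iota 0 n.+1].

Definition lower (n : nat) (s : seq bitseq) (l : nat) : nat :=
  foldr maxn l [seq coded_wiener n s x | x <- iota 0 n.+1].

(* A lists edges known to be present and A ++ B contains all edges; l and h
   bound twice the common Wiener index.  Conditionals are used instead of
   boolean connectives to keep the evaluation lazy. *)
Fixpoint refute (n : nat) (bad : pred (seq bitseq)) (A B : seq bitseq)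
    (l h : nat) : bool :=
  if B is e :: B' then
    if (if bad (e :: A) then true else
        let h' := upper n (e :: A) h in
        if h' < l then true else refute n bad (e :: A) B' l h')
    then
      let l' := lower n (A ++ B') l in
      if h < l' then true else refute n bad A B' l' h
    else false
  else false.

(** * Soundness of the search *)

Section Refutation.

Variables (T : finType) (H : hypergraph T) (vs : seq T) (x0 : T) (k : nat).
Hypothesis uniq_vs : uniq vs.
Hypothesis V_vs : vertices H = [set y in vs].
Let n := size vs.
Hypothesis connH : connected H.
Hypothesis sumH : \sum_(u in vertices H) \sum_(w in vertices H) dist H u w = k.
Hypothesis conn_del : forall v, v \in vs -> connected (delete_vertex H v).
Hypothesis sum_del : forall v, v \in vs ->
  \sum_(u in vertices H :\ v) \sum_(w in vertices H :\ v)
     dist (delete_vertex H v) u w = k.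

Definition realized (A : seq bitseq) : Prop :=
  forall m, m \in A -> exists2 e, e \in hyperedges H & m = code vs e.

Definition covering (A : seq bitseq) : Prop :=
  sized n A /\ forall e, e \in hyperedges H -> code vs e \in A.

Lemma realized_sized A : realized A -> sized n A.
Proof. by move=> real; apply/allP=> m /real[e _ ->]; rewrite size_code. Qed.

Lemma vertices_delete x : x < n ->
  vertices (delete_vertex H (nth x0 vs x)) = [set y in vs | index y vs != x].
Proof.
move=> xn; apply/setP=> y; rewrite !inE V_vs inE andbC; apply: andb_id2l => yvs.
by rewrite -{1}(nth_index x0 yvs) nth_uniq // index_mem.
Qed.

(** Positions are below [n], so excluding position [n] excludes nothing, and [H] takes the same form
    as its deletions. *)
Lemma vertices_nodelete : vertices H = [set y in vs | index y vs != n].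
Proof.
apply/setP=> y; rewrite V_vs !inE; case: (boolP (y \in vs)) => //= yvs.
by rewrite neq_ltn index_mem yvs.
Qed.

Lemma coded_wiener_covering A x : covering A -> x <= n -> coded_wiener n A x <= k.
Proof.
move=> [sz cover]; rewrite leq_eqVlt => /predU1P[->|xn].
  by rewrite -sumH; apply: (coded_wiener_le x0 uniq_vs vertices_nodelete).
have xvs : nth x0 vs x \in vs by rewrite mem_nth.
rewrite -(sum_del xvs).
apply: (coded_wiener_le x0 uniq_vs (vertices_delete xn) (conn_del xvs)) => //.
by move=> e; rewrite inE => /andP[/cover].
Qed.

(** Fewer edges give longer distances. A pair not joined by the edges of [A] contributes [n], once
    per round, which still exceeds its true distance. *)
Lemma coded_wiener_realized A x : realized A -> x <= n -> k <= coded_wiener n A x.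
Proof.
move=> real; have sz := realized_sized real.
rewrite leq_eqVlt => /predU1P[->|xn].
  rewrite -sumH; apply: (coded_wiener_ge x0 uniq_vs vertices_nodelete) => //.
  by move=> m /real.
have xvs : nth x0 vs x \in vs by rewrite mem_nth.
rewrite -(sum_del xvs).
apply: (coded_wiener_ge x0 uniq_vs (vertices_delete xn) (conn_del xvs)) => //.
move=> m /real[e eE ->]; rewrite (nth_map x0) // => xe.
by exists e; rewrite // inE eE.
Qed.

Lemma within_delete A v i j r : realized A -> v < n -> i < n -> j < n -> i != v ->
  within n A v i j r ->
  dist (delete_vertex H (nth x0 vs v)) (nth x0 vs i) (nth x0 vs j) <= r.
Proof.
move=> real vn ivs jvs iv; have vvs : nth x0 vs v \in vs by rewrite mem_nth.
move=> wth.
apply: (within_dist x0 uniq_vs (vertices_delete vn) (conn_del vvs)) wth => //.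
  exact: realized_sized.
move=> m /real[e eE ->]; rewrite (nth_map x0) // => ve.
by exists e; rewrite // inE eE.
Qed.

Lemma upperP A h : realized A -> k <= h -> k <= upper n A h.
Proof.
move=> real kh; rewrite /upper; have: {subset iota 0 n.+1 <= [pred x | x <= n]}.
  by move=> x; rewrite mem_iota.
elim: (iota _ _) => //= x r IHr rP; rewrite leq_min IHr ?andbT.
  by apply: coded_wiener_realized real (rP x _); rewrite mem_head.
by move=> y yr; apply: rP; rewrite inE yr orbT.
Qed.

Lemma lowerP A l : covering A -> l <= k -> lower n A l <= k.
Proof.
move=> cover lk; rewrite /lower; have: {subset iota 0 n.+1 <= [pred x | x <= n]}.
  by move=> x; rewrite mem_iota.
elim: (iota _ _) => //= x r IHr rP; rewrite geq_max IHr ?andbT.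
  by apply: coded_wiener_covering cover (rP x _); rewrite mem_head.
by move=> y yr; apply: rP; rewrite inE yr orbT.
Qed.

(** The actual hypergraph [H] selects one branch at each triple [e], according to whether [e] codes
    an edge. Along these choices the bounds enclose [k] and [bad] fails, so no test closes the
    branch; once [B] is empty, [refute] answers [false]. *)
Lemma refuteP bad A B l h : (forall s, realized s -> ~~ bad s) ->
  realized A -> covering (A ++ B) -> l <= k -> k <= h -> ~~ refute n bad A B l h.
Proof.
move=> badP; elim: B A l h => //= e B IHB A l h real cover lk kh.
have [sz covers] := cover.
have [/existsP[e' /andP[e'E /eqP e'e]]|] :=
    boolP [exists e', (e' \in hyperedges H) && (code vs e' == e)].
  have real' : realized (e :: A).
    by move=> m; rewrite inE => /predU1P[->|/real//]; exists e'.
  have kh' := upperP real' kh.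
  have lh' := leq_trans lk kh'.
  rewrite (negPf (badP _ real')) ltnNge lh' /=.
  have cover' : covering ((e :: A) ++ B).
    split=> [|f fE].
      by move: sz; rewrite /sized /= !all_cat /= andbCA.
    by have := covers _ fE; rewrite !(inE, mem_cat) orbCA.
  by rewrite (negPf (IHB _ _ _ real' cover' lk kh')).
move/existsPn => noe; case: ifP => // _.
have cover' : covering (A ++ B).
  split=> [|f fE].
    by move: sz; rewrite /sized /= !all_cat /= => /and3P[-> _ ->].
  have := covers _ fE; rewrite !(inE, mem_cat) orbCA => /predU1P[fe|//].
  by have := noe f; rewrite fE fe eqxx.
have lk' := lowerP cover' lk.
by rewrite ltnNge (leq_trans lk' kh) /= IHB.
Qed.

End Refutation.

(** * Codes of triples and the four computations *)

Fixpoint combs (n k : nat) : seq bitseq :=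
  if n is n'.+1 then
    [seq false :: m | m <- combs n' k] ++
    (if k is k'.+1 then [seq true :: m | m <- combs n' k'] else [::])
  else if k is 0 then [:: [::]] else [::].

Lemma mem_combs (m : bitseq) : m \in combs (size m) (count id m).
Proof.
elim: m => [|x m IHm] //=; rewrite mem_cat.
by case: x => /=; rewrite ?add1n ?add0n map_f ?orbT.
Qed.

Lemma sized_combs n k : sized n (combs n k).
Proof.
elim: n k => [|n IHn] k; first by case: k.
apply/allP=> m /=; rewrite mem_cat => /orP[/mapP[m' /(allP (IHn _)) ? ->] //|].
by case: k => // k /mapP[m' /(allP (IHn _)) ? ->].
Qed.

Definition triple (n : nat) (t : nat * nat * nat) : bitseq :=
  let: (i, j, k) := t in [seq x \in [:: i; j; k] | x <- iota 0 n].

Lemma code_triple (T : finType) (vs : seq T) (x0 : T) (i j k : nat) : uniq vs ->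
  i < size vs -> j < size vs -> k < size vs ->
  code vs [set nth x0 vs i; nth x0 vs j; nth x0 vs k] = triple (size vs) (i, j, k).
Proof.
move=> uvs iv jv kv; apply: (@eq_from_nth _ false); rewrite !size_map ?size_iota //.
move=> x xv; rewrite (nth_map x0) // (nth_map 0) ?size_iota // nth_iota // add0n.
by rewrite !inE !nth_uniq // orbA.
Qed.

(** A state is bad when, with vertex 8 deleted, 0 and 4 are within distance 3, against the geodesic.
    In the four cases below [rest] consists of the triples that create such a shortcut at once, so
    they are discarded first and branching only concerns [order]. *)
Definition search (known order : seq (nat * nat * nat)) : bool :=
  let A := map (triple 9) known in
  let B := map (triple 9) order in
  let rest := [seq m <- combs 9 3 | m \notin A ++ B] in
  refute 9 (fun s => within 9 s 8 0 4 3) A (rest ++ B) 0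
    (upper 9 A (coded_wiener 9 A 9)).

(* Labels: 8 is the deleted vertex v, 0, ..., 4 is a geodesic of H \ v, and the
   suffix lists the third vertices of its four edges.  The orders come from a
   local search for a small refutation tree. *)
Definition known_5566 := [:: (0, 1, 5); (1, 2, 5); (2, 3, 6); (3, 4, 6)].
Definition known_5567 := [:: (0, 1, 5); (1, 2, 5); (2, 3, 6); (3, 4, 7)].
Definition known_5667 := [:: (0, 1, 5); (1, 2, 6); (2, 3, 6); (3, 4, 7)].
Definition known_5677 := [:: (0, 1, 5); (1, 2, 6); (2, 3, 7); (3, 4, 7)].

Definition order_5566 :=
  [:: (1, 3, 8); (2, 4, 8); (5, 6, 8); (0, 6, 8); (1, 4, 8); (0, 3, 8); (0, 4, 8);
      (3, 5, 8); (0, 2, 8); (1, 6, 8); (4, 5, 8); (3, 7, 8); (0, 7, 8); (0, 1, 8);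
      (0, 1, 7); (2, 3, 7); (2, 3, 8); (3, 4, 8); (3, 4, 7); (0, 5, 8); (0, 5, 7);
      (3, 6, 8); (3, 6, 7); (1, 2, 8); (1, 7, 8); (1, 2, 7); (4, 7, 8); (4, 6, 7);
      (4, 6, 8); (1, 5, 8); (1, 5, 7); (2, 6, 8); (2, 5, 8); (2, 7, 8); (6, 7, 8);
      (2, 6, 7); (5, 7, 8); (2, 5, 7)].

Definition order_5567 :=
  [:: (3, 5, 8); (2, 4, 8); (1, 3, 8); (1, 7, 8); (4, 5, 8); (5, 7, 8); (1, 4, 8);
      (2, 6, 7); (2, 3, 7); (0, 3, 8); (0, 6, 8); (0, 2, 8); (2, 7, 8); (0, 7, 8);
      (0, 4, 8); (4, 6, 8); (1, 2, 8); (1, 6, 8); (4, 7, 8); (4, 6, 7); (1, 2, 6);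
      (0, 1, 8); (3, 4, 8); (3, 4, 6); (6, 7, 8); (3, 6, 8); (2, 6, 8); (5, 6, 8);
      (1, 5, 6); (3, 6, 7); (2, 5, 6); (1, 5, 8); (3, 7, 8); (2, 5, 8); (0, 5, 8);
      (2, 3, 8)].

Definition order_5667 :=
  [:: (2, 4, 8); (0, 3, 8); (1, 4, 8); (0, 4, 8); (0, 1, 8); (0, 2, 8); (0, 7, 8);
      (0, 6, 8); (4, 6, 8); (3, 4, 8); (4, 5, 8); (3, 6, 8); (6, 7, 8); (5, 6, 8);
      (1, 6, 8); (1, 5, 6); (3, 6, 7); (1, 7, 8); (2, 6, 8); (5, 7, 8); (3, 5, 8);
      (2, 7, 8); (1, 3, 8); (2, 3, 8); (3, 7, 8); (2, 6, 7); (4, 7, 8); (2, 3, 7);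
      (0, 5, 8); (2, 5, 8); (1, 2, 5); (1, 5, 8); (2, 5, 6); (1, 2, 8)].

Definition order_5677 :=
  [:: (1, 7, 8); (0, 2, 8); (1, 3, 8); (2, 5, 8); (3, 5, 8); (0, 7, 8); (0, 3, 8);
      (5, 7, 8); (1, 4, 8); (4, 6, 8); (2, 4, 8); (4, 5, 8); (0, 4, 8); (1, 2, 5);
      (2, 5, 6); (5, 6, 8); (0, 6, 8); (0, 1, 8); (0, 1, 6); (3, 6, 7); (2, 6, 7);
      (2, 3, 6); (0, 5, 6); (0, 5, 8); (1, 5, 6); (1, 5, 8); (3, 6, 8); (6, 7, 8);
      (2, 6, 8); (1, 6, 8); (4, 7, 8); (3, 4, 8); (2, 7, 8); (2, 3, 8); (3, 7, 8);
      (1, 2, 8)].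

Lemma search_5566 : search known_5566 order_5566.
Proof. by vm_compute. Qed.

Lemma search_5567 : search known_5567 order_5567.
Proof. by vm_compute. Qed.

Lemma search_5667 : search known_5667 order_5667.
Proof. by vm_compute. Qed.

Lemma search_5677 : search known_5677 order_5677.
Proof. by vm_compute. Qed.

(** * Labelling the vertices along a long geodesic *)

Section Labelling.

Variables (T : finType) (H : hypergraph T) (k : nat).
Hypotheses (H3 : uniform 3 H) (H9 : horder H = 9).
Let V := vertices H.
Hypothesis connH : connected H.
Hypothesis sumH : \sum_(u in V) \sum_(w in V) dist H u w = k.
Hypothesis conn_del : forall v, v \in V -> connected (delete_vertex H v).
Hypothesis sum_del : forall v, v \in V ->
  \sum_(u in V :\ v) \sum_(w in V :\ v) dist (delete_vertex H v) u w = k.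

(** Nine distinct vertices exhaust [V], so positions in [vs] serve as labels. The known edges are
    realized, and [combs 9 3] contains the code of every edge, so the soundness of [refute]
    applies. *)
Lemma labelling_contra (vs : seq T) (x0 : T) known order :
  size vs = 9 -> uniq vs -> {subset vs <= V} ->
  3 < dist (delete_vertex H (nth x0 vs 8)) (nth x0 vs 0) (nth x0 vs 4) ->
  (forall i j k, (i, j, k) \in known -> [&& i < 9, j < 9 & k < 9] /\
     [set nth x0 vs i; nth x0 vs j; nth x0 vs k] \in hyperedges H) ->
  ~~ search known order.
Proof.
move=> sz uvs vsV far edges.
have V_vs : V = [set y in vs].
  apply/esym/eqP; rewrite eqEcard; apply/andP; split.
    by apply/subsetP=> y; rewrite inE => /vsV.
  by rewrite -/(horder H) H9 cardsE (card_uniqP uvs) sz.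
have vvs v : v \in vs -> v \in V by move/vsV.
have conn' v (vv : v \in vs) := conn_del (vvs v vv).
have sum' v (vv : v \in vs) := sum_del (vvs v vv).
rewrite /search; set A := map _ known; set B := map _ order; set rest := filter _ _.
have real : realized H vs A.
  move=> m /mapP[[[i j] l] /edges[/and3P[iv jv lv] eE] ->].
  by eexists; [exact: eE|rewrite code_triple ?sz].
have trsz s : sized 9 (map (triple 9) s).
  by rewrite /sized all_map; apply/allP=> -[[i j] l] _.
have cover : covering H vs (A ++ rest ++ B).
  split.
    rewrite sz /sized !all_cat; apply/and3P; split; [exact: trsz| |exact: trsz].
    by apply/allP=> m; rewrite mem_filter => /andP[_ /(allP (sized_combs 9 3))].
  move=> e eE; rewrite !mem_cat mem_filter mem_cat.
  have : code vs e \in combs 9 3.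
    have := mem_combs (code vs e); rewrite size_code sz count_map.
    rewrite -size_filter -(card_uniqP (filter_uniq _ uvs)).
    suff /eq_card-> : [seq y <- vs | preim (mem e) id y] =i e by rewrite H3.
    move=> y; rewrite mem_filter /=; apply: andb_idr => /(edge_vertex eE).
    by rewrite -/V V_vs inE.
  by move=> ->; rewrite andbT negb_or; do 2!case: (_ \in _).
rewrite -sz; apply: (refuteP x0 uvs V_vs connH sumH conn' sum') => //.
- move=> s real_s; apply: contraL far => wth; rewrite -leqNgt.
  by apply: (within_delete x0 uvs V_vs conn' real_s) wth; rewrite ?sz.
- apply: (upperP x0 uvs V_vs connH sumH conn' sum') => //.
  by apply: (coded_wiener_realized x0 uvs V_vs connH sumH conn' sum'); rewrite // sz.
Qed.

Lemma edge_third (e : {set T}) (u w : T) : e \in hyperedges H -> u != w ->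
  u \in e -> w \in e -> exists a, [/\ e = [set u; w; a], a != u & a != w].
Proof.
move=> eE uw ue we.
have /eqP/cards1P[a ea] := card_edge_minus2 H3 eE uw ue we.
have : a \in e :\: [set u; w] by rewrite ea set11.
rewrite !inE negb_or => /andP[/andP[au aw] ae].
exists a; split=> //; apply/setP=> y; rewrite !inE.
have /setP/(_ y) := ea; rewrite !inE.
have [->|yu] := eqVneq y u; first by rewrite ue.
by have [->|yw] := eqVneq y w; first by rewrite we.
Qed.

(** The distance [f] from [u] sorts vertices into layers. It limits the coincidences among the third
    vertices [a], [b], [c], [d] of the first four edges of the geodesic to consecutive ones, and
    each possible pattern is refuted by a computation. *)
Lemma diam_delete_le3 (v u w : T) : v \in V -> u \in V :\ v -> w \in V :\ v ->
  dist (delete_vertex H v) u w <= 3.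
Proof.
move=> vV uV wV; rewrite leqNgt; apply/negP; set G := delete_vertex H v => far.
have connG : connected G by apply: conn_del.
have /has_walkE[p [sp pth lst]] := dist_walk (connG _ _ uV wV).
case: p sp pth lst => [|x1 [|x2 [|x3 [|x4 p]]]] /= sp; rewrite -?sp // in far *.
case/and5P=> c1 c2 c3 c4 pth lst.
have walkV y z : coedge G y z -> (y \in V :\ v) /\ (z \in V :\ v).
  by case/coedgeP=> e [eE ye ze]; rewrite !(edge_vertex (H := G) eE).
pose f := dist G u.
have f_near y z : coedge G y z -> f z <= (f y).+1.
  move=> yz; have [yV _] := walkV _ _ yz.
  exact: dist_coedge (connG _ _ uV yV) yz.
(* A shorter way to [x4], continued along [p], would shorten the geodesic. *)
have f4 : 3 < f x4.
  have := dist_walk (connG _ _ uV (walkV _ _ c4).2).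
  move/has_walk_path/(_ pth); rewrite lst => /dist_le.
  by rewrite -sp -[(size p).+4]/(4 + size p) leq_add2r.
have f0 : f u = 0 by apply: dist_refl.
have [f1 f2 f3 {}f4] : [/\ f x1 = 1, f x2 = 2, f x3 = 3 & f x4 = 4].
  move: (f_near _ _ c1) (f_near _ _ c2) (f_near _ _ c3) (f_near _ _ c4).
  rewrite f0 => n1 n2 n3 n4.
  have l3 : 2 < f x3 := leq_trans f4 n4.
  have l2 : 1 < f x2 := leq_trans l3 n3.
  have l1 : 0 < f x1 := leq_trans l2 n2.
  have u2 : f x2 <= 2 := leq_trans n2 (n1 : _ < 2).
  have u3 : f x3 <= 3 := leq_trans n3 (u2 : _ < 3).
  have u4 : f x4 <= 4 := leq_trans n4 (u3 : _ < 4).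
  by split; apply/eqP; rewrite eqn_leq; apply/andP.
have neqf y z : f y != f z -> y != z by apply: contraNneq => ->.
have third y z : coedge G y z -> f y != f z -> exists a,
    [/\ [set y; z; a] \in hyperedges H, a \in V :\ v, a != y, a != z &
        f a <= (f y).+1 /\ f z <= (f a).+1].
  case/coedgeP=> e [eG ye ze] /neqf yz; have := eG; rewrite inE => /andP[eE ve].
  have [a [e_eq ay az]] := edge_third eE yz ye ze.
  have ae : a \in e by rewrite e_eq !inE eqxx orbT.
  exists a; rewrite -e_eq; split=> //; first exact: (edge_vertex (H := G)) ae.
  by split; apply: f_near; apply/coedgeP; exists e.
have [|a [e1 aV au ax1 [fa _]]] := third _ _ c1; first by rewrite f0 f1.
have [|b [e2 bV bx1 bx2 [fb fb']]] := third _ _ c2; first by rewrite f1 f2.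
have [|c [e3 cV cx2 cx3 [fc fc']]] := third _ _ c3; first by rewrite f2 f3.
have [|d [e4 dV dx3 dx4 [_ fd]]] := third _ _ c4; first by rewrite f3 f4.
(* The near bound at [x1] only gives [f a] at least 0; the lower bound 1 comes from [a != u]. *)
have {}fa : f a = 1.
  apply/eqP; rewrite eqn_leq -{1}f0 fa lt0n; apply: contraNneq au => /dist_eq0 -> //.
  exact: connG.
have inV y : y \in V :\ v -> (y \in V) /\ (y != v) by rewrite !inE => /andP[].
have [uV' uv] := inV _ uV.
have [aV' av] := inV _ aV.
have [bV' bv] := inV _ bV.
have [cV' cv] := inV _ cV.
have [dV' dv] := inV _ dV.
have [x1V x1v] := inV _ (walkV _ _ c1).2.
have [x2V x2v] := inV _ (walkV _ _ c2).2.
have [x3V x3v] := inV _ (walkV _ _ c3).2.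
have [x4V x4v] := inV _ (walkV _ _ c4).2.
pose base := [:: u; x1; x2; x3; x4; v].
have uniq_base : uniq base.
  rewrite -[base]/([:: u; x1; x2; x3; x4] ++ [:: v]) cat_uniq.
  apply/and3P; split=> //.
    by apply: (@map_uniq _ _ f); rewrite /= f0 f1 f2 f3 f4.
  by rewrite /= !inE !negb_or ![v == _]eq_sym uv x1v x2v x3v x4v.
have ltf y z : f y < f z -> y != z by apply: contraTneq => ->; rewrite ltnn.
have gtf y z : f z < f y -> y != z by apply: contraTneq => ->; rewrite ltnn.
rewrite ?(f1, f2, f3, f4, ltnS) in fb fb' fc fc' fd.
have a_base : a \notin base.
  by rewrite !inE !negb_or au ax1 av !ltf ?fa ?f2 ?f3 ?f4.
have b_base : b \notin base.
  rewrite !inE !negb_or bx1 bx2 bv.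
  by rewrite (gtf b u) ?(ltf b x3) ?(ltf b x4) ?f0 ?f3 ?f4 //; apply: leqW.
have c_base : c \notin base.
  rewrite !inE !negb_or cx2 cx3 cv.
  by rewrite (ltf c x4) ?(gtf c u) ?(gtf c x1) ?f0 ?f1 ?f4 //; apply: ltnW.
have d_base : d \notin base.
  rewrite !inE !negb_or dx3 dx4 dv.
  rewrite (gtf d u) ?(gtf d x1) ?(gtf d x2) ?f0 ?f1 ?f2 // ?(ltnW fd) //.
  by rewrite (ltn_trans _ fd).
(* The layers are 1 for [a], 1 or 2 for [b], 2 or 3 for [c], and at least 3 for [d], which separates
   all non-consecutive ones. *)
have ac : a != c by rewrite ltf // fa.
have ad : a != d by rewrite ltf // fa ltnW.
have bd : b != d by rewrite ltf // (leq_ltn_trans fb fd).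
have baseV : {subset base <= V}.
  by move=> y; rewrite !inE => /or4P[||| /or3P[]] /eqP->.
have refuted t1 t2 t3 known order : t1 \notin base -> t2 \notin base ->
    t3 \notin base -> [/\ t1 != t2, t1 != t3 & t2 != t3] ->
    [/\ t1 \in V, t2 \in V & t3 \in V] ->
    let vs := [:: u; x1; x2; x3; x4; t1; t2; t3; v] in
    (forall i j k, (i, j, k) \in known -> [&& i < 9, j < 9 & k < 9] /\
     [set nth u vs i; nth u vs j; nth u vs k] \in hyperedges H) ->
    search known order -> False.
  move=> t1b t2b t3b [t12 t13 t23] [t1V t2V t3V] vs edges.
  apply/negP/(labelling_contra (vs := vs) (x0 := u)) => //;
    last by rewrite /= -/(f _) f4.
    rewrite (uniq_catCA [:: u; x1; x2; x3; x4] [:: t1; t2; t3] [:: v]).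
    rewrite cat_uniq; apply/and3P; split=> //.
      by rewrite /= !inE negb_or t12 t13 t23.
    by rewrite has_sym -all_predC; apply/and4P.
  move=> y yvs; have : y \in [:: t1; t2; t3] ++ base.
    move: yvs; rewrite !(inE, mem_cat).
    by move=> /or4P[||| /or4P[||| /or3P[]]] ->; rewrite ?orbT.
  by rewrite mem_cat => /orP[|/baseV//]; rewrite !inE => /or3P[]/eqP->.
have [ab|ab] := eqVneq a b.
- subst b; have [cd|cd] := eqVneq c d.
  + subst d.
    (* Only eight vertices are named in this case; a ninth one, [z], takes label 7. *)
    have /subsetPn[z zV] : ~~ (V \subset [:: a, c & base]).
      apply/negP=> /subset_leq_card; rewrite -/(horder H) H9.
      by move=> /leq_trans/(_ (card_size _)).
    rewrite 2!in_cons 2!negb_or => /and3P[za zc zb].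
    apply: (refuted _ _ _ _ _ a_base c_base zb _ _ _ search_5566).
      by rewrite ac ![_ == z]eq_sym.
      by [].
    by move=> i j l; rewrite !inE => /or4P[]/eqP[-> -> ->].
  + apply: (refuted _ _ _ _ _ a_base c_base d_base _ _ _ search_5567) => //.
    by move=> i j l; rewrite !inE => /or4P[]/eqP[-> -> ->].
- have [bc|bc] := eqVneq b c.
  + subst c; apply: (refuted _ _ _ _ _ a_base b_base d_base _ _ _ search_5667) => //.
    by move=> i j l; rewrite !inE => /or4P[]/eqP[-> -> ->].
  + have dc : d = c.
      (* Four distinct third vertices together with [base] would make ten vertices. *)
      apply/eqP/negPn/negP=> dc.
      have : uniq ([:: a; b; c; d] ++ base).
        rewrite cat_uniq; apply/and3P; split=> //.
          by rewrite /= !inE !negb_or ab ac ad bc bd eq_sym dc.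
        by rewrite has_sym -all_predC; apply/and5P.
      move/card_uniqP => card10.
      have /subset_leq_card : [:: a; b; c; d] ++ base \subset V.
        apply/subsetP=> y; rewrite mem_cat => /orP[|/baseV//].
        by rewrite !inE => /or4P[]/eqP->.
      by rewrite card10 -/(horder H) H9.
    subst d; apply: (refuted _ _ _ _ _ a_base b_base c_base _ _ _ search_5677) => //.
    by move=> i j l; rewrite !inE => /or4P[]/eqP[-> -> ->].
Qed.

End Labelling.

Theorem mainTheorem6 (T : finType) (H : hypergraph T) :
  uniform 3 H -> horder H = 9 -> ~ soltes H.
Proof.
move=> H3 H9 [connH eqW].
case W: (wiener H) (connected_wiener connH) => [m|] // _.
have [_ sumH] := wiener_dist W.
have delW v : v \in vertices H -> wiener (delete_vertex H v) = Some m.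
  by move/eqW->.
have conn_del v (vV : v \in vertices H) := (wiener_dist (delW v vV)).1.
have sum_del v (vV : v \in vertices H) := (wiener_dist (delW v vV)).2.
apply: (diam_del_contra H3 H9 _ connH sumH sum_del).
exact: (diam_delete_le3 H3 H9 connH sumH conn_del sum_del).
Qed.
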